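(* Let $\mathbb{F}$ be $\mathbb{R}$ or $\mathbb{C}$, let $\langle\cdot,\cdot\rangle$ be an inner product (non-degenerate symmetric bilinear form) on $\mathbb{F}^n$, and let $\mathcal{R}$ be a semisimple algebraic curvature tensor on $(\mathbb{F}^n,\langle\cdot,\cdot\rangle)$. Then $\mathcal{R}$ is Osserman if and only if it satisfies the duality principle.
   Context: $\mathbb{F}$ is $\mathbb{R}$ or $\mathbb{C}$. An inner product on $\mathbb{F}^n$ is a non-degenerate symmetric $\mathbb{F}$-bilinear form $\langle\cdot,\cdot\rangle$ (of arbitrary signature when $\mathbb{F}=\mathbb{R}$; bilinear, not Hermitian, when $\mathbb{F}=\mathbb{C}$); $\|X\|^2=\langle X,X\rangle$ is the associated quadratic form. A vector $X$ is null if $\|X\|^2=0$. An algebraic curvature tensor $\mathcal{R}$ on $(\mathbb{F}^n,\langle\cdot,\cdot\rangle)$ is a three-linear map $(X,Y,Z)\mapsto\mathcal{R}(X,Y)Z\in\mathbb{F}^n$, $X,Y,Z\in\mathbb{F}^n$, such that for all $X,Y,Z,V$: $\mathcal{R}(X,Y)Z=-\mathcal{R}(Y,X)Z$; $\mathcal{R}(X,Y)Z+\mathcal{R}(Y,Z)X+\mathcal{R}(Z,X)Y=0$; $\langle\mathcal{R}(X,Y)Z,V\rangle=\langle\mathcal{R}(Z,V)X,Y\rangle$. The Jacobi operator $\mathcal{R}_X$ is the linear operator on $\mathbb{F}^n$ given by $\mathcal{R}_X(Y)=\mathcal{R}(Y,X)X$. $\mathcal{R}$ is semisimple if the set $s_{\mathcal{R}}$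 of those $X\in\mathbb{F}^n$ for which $\mathcal{R}_X$ is diagonalisable over $\mathbb{F}$ has a nonempty interior in $\mathbb{F}^n$ (Euclidean topology). $\mathcal{R}$ is Osserman if there exists a polynomial $P\in\mathbb{F}[t,y]$ such that the characteristic polynomial $\chi_X(t)$ of $\mathcal{R}_X$ equals $P(t,\|X\|^2)$ for all $X\in\mathbb{F}^n$. $\mathcal{R}$ satisfies the duality principle if for any non-null $X\in\mathbb{F}^n$ and any eigenvector $Y$ of $\mathcal{R}_X$, the vector $X$ is an eigenvector of $\mathcal{R}_Y$. An eigenvector is a nonzero vector of $\mathbb{F}^n$ (with eigenvalue in $\mathbb{F}$). *)

(* Defs.v *)
From HB Require Import structures.
From mathcomp Require Import all_boot all_order all_algebra.
From mathcomp Require Import all_classical all_reals all_analysis.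
From mathcomp Require Export sesquilinear mxred complex.
Set Implicit Arguments.
Unset Strict Implicit.
Unset Printing Implicit Defensive.
Import Order.TTheory GRing.Theory Num.Theory.
Import numFieldNormedType.Exports.
Local Open Scope classical_set_scope.
Local Open Scope ring_scope.

(* F is meant to be R or R[i] for R : realType. Its topology is the one of its
   norm (the modulus on R[i]), and 'rV[F]_n carries the sup-norm topology, i.e.
   the Euclidean one. *)

Section Curvature.
Variables (F : numFieldType) (n : nat).
Local Notation V := 'rV[F]_n.

Definition trilinear (T : V -> V -> V -> V) : Prop :=
  [/\ forall Y Z, linear (fun X => T X Y Z),
      forall X Z, linear (fun Y => T X Y Z)
    & forall X Y, linear (fun Z => T X Y Z)].

(* T X Y Z stands for T(X, Y)Z. *)
Definition algebraic_curvature_tensor (g : {symmetric V})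
    (T : V -> V -> V -> V) : Prop :=
  [/\ trilinear T,
      forall X Y Z, T X Y Z = - T Y X Z,
      forall X Y Z, T X Y Z + T Y Z X + T Z X Y = 0
    & forall X Y Z W, g (T X Y Z) W = g (T Z W X) Y].

Definition jacobi (T : V -> V -> V -> V) (X : V) : V -> V :=
  fun Y => T Y X X.

(* Matrices act on row vectors from the right: when T is trilinear,
   Y *m jacobi_mx T X = jacobi T X Y. *)
Definition jacobi_mx (T : V -> V -> V -> V) (X : V) : 'M[F]_n :=
  lin1_mx (jacobi T X).

Definition semisimple (T : V -> V -> V -> V) : Prop :=
  [set X : V | diagonalizable (jacobi_mx T X)]° !=set0.

(* A polynomial P(t, y) is encoded with y as the outer variable: evaluating it
   at the constant polynomial c%:P gives P(t, c) as a polynomial in t. *)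
Definition osserman (g : {symmetric V}) (T : V -> V -> V -> V) : Prop :=
  exists P : {poly {poly F}},
    forall X : V, char_poly (jacobi_mx T X) = P.[(g X X)%:P].

Definition eigenvector (f : V -> V) (Y : V) : Prop :=
  Y != 0 /\ exists a : F, f Y = a *: Y.

Definition duality_principle (g : {symmetric V}) (T : V -> V -> V -> V) : Prop :=
  forall X Y : V, g X X != 0 ->
    eigenvector (jacobi T X) Y -> eigenvector (jacobi T Y) X.

End Curvature.

(* Main.v *)
Require Import Defs.
From HB Require Import structures.
From mathcomp Require Import all_boot all_order all_algebra.
From mathcomp Require Import all_classical all_reals all_analysis.
From mathcomp Require Import complex perm ring.
Import Order.TTheory GRing.Theory Num.Theory.
Import numFieldNormedType.Exports.
Local Open Scope ring_scope.

(** Write [q X] for [g X X], [J X] for the Jacobi operator and [K(X, Y)] for the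
    derivative of [J] at [X] along [Y]. The symmetries of the curvature tensor
    give [g (K(X, Y) W) W = 2 g (J_W X) Y], which turns a statement on [J_W X]
    into a statement on the first variation of [J] at [X].

    If duality holds, an eigenvector [W] of [J X] for the eigenvalue [a]
    satisfies [g (K(X, Y) W) W = 2 a (g X Y / q X) q W]: to first order, all the
    eigenvalues of [J] scale like [q]. Hence [h = det (t q - J)] satisfies
    [q dh = n h dq] wherever [J] is diagonalizable, which is an open set, and
    integrating along lines, where everything is polynomial, [h] is a constant
    multiple of [q ^ n] everywhere.

    Conversely, if [T] is Osserman, the eigenvalues of [J X] are [l * q X] with
    [l] in a fixed finite set [L], so that [\prod_(l in L) (J X - l q X)]
    vanishes where [J X] is diagonalizable, hence everywhere. Differentiating
    this product at [X] between two copies of an eigenvector [Y] for the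
    eigenvalue [l q X], only the factor of [l] needs to be differentiated, and
    [g (K(X, Z) Y) Y = 2 l (g X Z) (q Y)] for all [Z], that is
    [J_Y X = l (q Y) X]. *)

(** * Polynomial identities and derivatives of determinants *)

Section LinearAlgebra.
Set Implicit Arguments.
Unset Strict Implicit.
Variable F : numFieldType.

(** The points [e / (k + 2)] with [k < size p] are more roots than a nonzero [p] can have. *)
Lemma poly_eq0_near (p : {poly F}) (e : F) :
  0 < e -> (forall s, `|s| < e -> p.[s] = 0) -> p = 0.
Proof.
move=> e0 pe; apply/eqP/negPn/negP => p0.
pose rs := [seq e / k.+2%:R | k <- iota 0 (size p)].
suff: (size rs < size p)%N by rewrite size_map size_iota ltnn.
apply: max_poly_roots p0 _ _.
  apply/allP => _ /mapP[k _ ->]; apply/rootP/pe.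
  rewrite gtr0_norm ?divr_gt0 ?ltr0n// ltr_pdivrMr ?ltr0n//.
  by rewrite ltr_pMr// ltr1n.
rewrite map_inj_uniq ?iota_uniq// => i j /mulfI - /(_ (lt0r_neq0 e0)).
by move=> /invr_inj/eqP; rewrite eqr_nat => /eqP[].
Qed.

Lemma poly_eq0_horner (p : {poly F}) : (forall s, p.[s] = 0) -> p = 0.
Proof. by move=> p0; apply: (@poly_eq0_near p 1). Qed.

(** In degree [k], once the coefficients of [h] up to [k] vanish, the equation reduces to
    [q_0 (k + 1) h_(k + 1) = 0]. *)
Lemma deriv_ode_uniq (m : nat) (q h : {poly F}) :
  q.[0] != 0 -> q * h^`() = (q^`() * h) *+ m -> h.[0] = 0 -> h = 0.
Proof.
rewrite !horner_coef0 => q0 qh h0; apply/polyP => k; rewrite coef0.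
elim/ltn_ind: k => -[|k] IH //.
move/(congr1 (fun p : {poly F} => p`_k)): qh.
rewrite coefMn !coefM [X in _ = X *+ _]big1 ?mul0rn => [|i _]; last first.
  by rewrite IH ?mulr0// ltnS leq_subr.
rewrite big_ord_recl /= subn0 coef_deriv big1 ?addr0 => [|i _]; last first.
  by rewrite coef_deriv IH ?mul0rn ?mulr0// /bump /= add1n ltnS ltn_subrL /=
    (leq_ltn_trans _ (ltn_ord i)).
by move=> /eqP; rewrite mulf_eq0 (negPf q0) /= mulrn_eq0 /= => /eqP.
Qed.

(** Both [f] and [q ^+ m] solve this linear equation, and uniqueness applies to their combination
    that vanishes at 0. *)
Lemma deriv_ode_expn (m : nat) (q f : {poly F}) :
  q.[0] != 0 -> q * f^`() = (q^`() * f) *+ m ->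
  f * (q.[0] ^+ m)%:P = f.[0]%:P * q ^+ m.
Proof.
move=> q0 qf; apply/eqP; rewrite -subr_eq0; apply/eqP.
apply: (@deriv_ode_uniq m q) => //; last first.
  by rewrite !(hornerE, horner_exp) subrr.
rewrite derivB !derivM !derivC mulr0 addr0 mul0r add0r deriv_exp.
rewrite mulrBr mulrA qf; case: m {qf} => [|m] /=; first by rewrite !mulr0n; ring.
set c := polyC _; rewrite [q ^+ _.+1]exprS; ring.
Qed.

(** Where [N] is diagonal, only the identity permutation contributes to first order, and each of its
    [n] factors has derivative [k] times its value. *)
Lemma det_deriv_diag (n : nat) (N : 'M[{poly F}]_n) (s k : F) (d : 'rV[F]_n) :
  map_mx (horner_eval s) N = diag_mx d ->
  (forall i, (N i i)^`().[s] = k * d 0 i) ->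
  (\det N)^`().[s] = (k * (\det N).[s]) *+ n.
Proof.
move=> Nd N'.
have Ns i j : (N i j).[s] = d 0 i *+ (i == j).
  by move/matrixP/(_ i j): Nd; rewrite !mxE /horner_eval => ->.
have det_s : (\det N).[s] = (\prod_i N i i).[s].
  rewrite -[LHS]/(horner_eval s (\det N)) -det_map_mx Nd det_diag.
  by rewrite horner_prod; apply: eq_bigr => i _; rewrite Ns eqxx.
rewrite det_s /determinant (raddf_sum (@deriv F)) /= horner_sum (bigD1 (1%g : 'S_n)) //=.
rewrite [X in _ + X]big1 ?addr0 => [|p p1]; last first.
  (* a nontrivial permutation moves two points, so its term vanishes to order 2 *)
  have [i pi] : exists i, p i != i.
    apply/existsP; rewrite -negb_forall; apply: contra p1 => /forallP p1.
    by apply/eqP/permP => i; rewrite perm1; apply/eqP.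
  rewrite (bigD1 i) //= (bigD1 (p i)) //=.
  have pi' : (i == p i) = false by rewrite eq_sym (negPf pi).
  have ppi : (p i == p (p i)) = false by rewrite (inj_eq perm_inj).
  set r := \prod_(j | _) _.
  rewrite !derivM; rewrite !(hornerM, hornerD) !Ns pi' ppi !mulr0n; ring.
rewrite odd_perm1 expr0 mul1r.
under eq_bigr do rewrite perm1.
rewrite -[X in _ *+ X]card_ord -sum1_card.
elim: (index_enum _) => [|i r IH]; first by rewrite !big_nil derivC horner0.
rewrite !big_cons derivM hornerD !hornerM IH N' Ns eqxx mulr1n mulrS; ring.
Qed.

Lemma det_deriv_conj (n : nat) (N : 'M[{poly F}]_n) (P : 'M[F]_n) (s k : F)
    (d : 'rV[F]_n) :
  P \in unitmx ->
  P *m map_mx (horner_eval s) N *m invmx P = diag_mx d ->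
  (forall i, (P *m map_mx (fun p => p^`().[s]) N *m invmx P) i i = k * d 0 i) ->
  (\det N)^`().[s] = (k * (\det N).[s]) *+ n.
Proof.
move=> Pu Nd N'.
pose PP := map_mx polyC P; pose PI := map_mx polyC (invmx P).
have PPI : PP *m PI = 1%:M by rewrite -map_mxM mulmxV// map_mx1.
have hC m (A : 'M[F]_m) : map_mx (horner_eval s) (map_mx polyC A) = A.
  by apply/matrixP => i j; rewrite !mxE /horner_eval hornerC.
have -> : \det N = \det (PP *m N *m PI).
  by rewrite !det_mulmx mulrAC -det_mulmx PPI det1 mul1r.
apply: (@det_deriv_diag _ _ _ _ d) => [|i]; first by rewrite !map_mxM !hC.
rewrite -N' !mxE (raddf_sum (@deriv F)) /= horner_sum; apply: eq_bigr => j _.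
rewrite !mxE derivM derivC mulr0 addr0 !hornerE; congr (_ * _).
rewrite (raddf_sum (@deriv F)) /= horner_sum; apply: eq_bigr => l _.
by rewrite !mxE derivM derivC mul0r add0r !hornerE.
Qed.

Lemma row_conj_diag (K : fieldType) (n : nat) (A P : 'M[K]_n) (d : 'rV[K]_n) i :
  P \in unitmx -> P *m A *m invmx P = diag_mx d ->
  row i P *m A = d 0 i *: row i P.
Proof.
move=> Pu PA.
by rewrite -row_mul -[P *m A](mulmxKV Pu) PA row_mul row_diag_mx -scalemxAl -rowE.
Qed.

(** * Symmetric forms and self-adjoint matrices *)

Section Form.
Variables (n : nat) (g : {symmetric 'rV[F]_n}).

Lemma sformC u v : g u v = g v u.
Proof. by rewrite hermC expr0 mul1r. Qed.

Lemma sformDl u v w : g (u + v) w = g u w + g v w.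
Proof. exact: linearDl. Qed.

Lemma sformZl a u v : g (a *: u) v = a * g u v.
Proof. exact: linearZl_LR. Qed.

Lemma sformDr u v w : g u (v + w) = g u v + g u w.
Proof. by rewrite sformC sformDl ![g _ u]sformC. Qed.

Lemma sformZr a u v : g u (a *: v) = a * g u v.
Proof. by rewrite sformC sformZl sformC. Qed.

Lemma sformNl u v : g (- u) v = - g u v.
Proof. by rewrite -scaleN1r sformZl mulN1r. Qed.

Lemma sform_suml (I : Type) (r : seq I) (P : pred I) (u : I -> 'rV[F]_n) v :
  g (\sum_(i <- r | P i) u i) v = \sum_(i <- r | P i) g (u i) v.
Proof. exact: linear_sumlz. Qed.

Lemma nondegenerate_eq0 u : nondegenerate g -> (forall v, g u v = 0) -> u = 0.
Proof.
move=> /eqP g0 gu; apply/eqP; rewrite -memv0 -g0.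
by apply/mem_orthovP => v _; exact: gu.
Qed.

(** The Gram matrix times the transpose of [v]: it turns a left eigenvector of a self-adjoint matrix
    into a right one. *)
Definition sform_col (v : 'rV[F]_n) : 'cV[F]_n := \col_i g (delta_mx 0 i) v.

Lemma mulmx_sform_col u v : u *m sform_col v = (g u v)%:M.
Proof.
apply/matrixP => i j; rewrite !ord1 !mxE eqxx mulr1n.
rewrite [in RHS](row_sum_delta u) sform_suml; apply: eq_bigr => k _.
by rewrite mxE sformZl.
Qed.

Definition self_adjoint (A : 'M[F]_n) := forall u v, g (u *m A) v = g u (v *m A).

Lemma mul_sform_col (A : 'M[F]_n) v : self_adjoint A ->
  A *m sform_col v = sform_col (v *m A).
Proof.
move=> As; apply/row_matrixP => i; rewrite row_mul mulmx_sform_col.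
by rewrite [RHS]rowE mulmx_sform_col rowE As.
Qed.

Lemma sform_polar (B : 'M[F]_n) u v (c : F) : self_adjoint B ->
  g (u *m B) u = c * g u u -> g (v *m B) v = c * g v v ->
  g ((u + v) *m B) (u + v) = c * g (u + v) (u + v) ->
  g (u *m B) v = c * g u v.
Proof.
move=> Bs uu vv; rewrite mulmxDl !sformDl !sformDr uu vv.
rewrite [g (v *m B) u]sformC -Bs [g v u]sformC => uv.
apply: (@mulIf _ 2%:R); first by rewrite pnatr_eq0.
move/eqP: uv; rewrite -subr_eq0 => /eqP uv; apply/eqP; rewrite -subr_eq0.
by rewrite -uv; apply/eqP; ring.
Qed.

(* The eigenspaces of a self-adjoint diagonalizable matrix are mutually
   orthogonal and nondegenerate, so a self-adjoint matrix acting as a scalar,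
   as a quadratic form, on each of them has that scalar as its diagonal
   entries, even in an eigenbasis that is not orthogonal. *)
Lemma diag_compression (A B P : 'M[F]_n) (d : 'rV[F]_n) (c : F) :
  nondegenerate g -> self_adjoint A -> self_adjoint B ->
  P \in unitmx -> P *m A *m invmx P = diag_mx d ->
  (forall u a, u *m A = a *: u -> g (u *m B) u = c * a * g u u) ->
  forall i, (P *m B *m invmx P) i i = c * d 0 i.
Proof.
move=> g_nd As Bs Pu PA cB i.
pose e j := row j P.
have eA j : e j *m A = d 0 j *: e j by apply: row_conj_diag.
have e_ortho j k : d 0 j != d 0 k -> g (e j) (e k) = 0.
  move=> djk; have := As (e j) (e k); rewrite !eA sformZl sformZr.
  by move=> /eqP; rewrite -subr_eq0 -mulrBl mulf_eq0 subr_eq0 (negPf djk) => /eqP.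
pose M := P *m B *m invmx P.
have eB j : e j *m B = \sum_k M j k *: e k.
  rewrite -row_mul -[P *m B](mulmxKV Pu) -/M row_mul mulmx_sum_row.
  by apply: eq_bigr => k _; rewrite mxE.
(* A sum of two vectors of one eigenspace stays in it, so the quadratic hypothesis polarizes. *)
have Bee j : d 0 j = d 0 i -> g (e i *m B) (e j) = c * d 0 i * g (e i) (e j).
  move=> dj; apply: sform_polar => //; apply: cB; rewrite ?eA ?dj//.
  by rewrite mulmxDl !eA dj scalerDr.
(* [r *m P] is the component of [e i *m B] in the eigenspace of [d 0 i], minus its expected value;
   entry [i] of [r = 0] is the claim. *)
pose r := \row_k (M i k *+ (d 0 k == d 0 i)) - (c * d 0 i) *: delta_mx 0 i.
have rP : r *m P = \sum_(k | d 0 k == d 0 i) M i k *: e k - (c * d 0 i) *: e i.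
  rewrite mulmxBl -scalemxAl -rowE; congr (_ - _).
  rewrite mulmx_sum_row [RHS]big_mkcond; apply: eq_bigr => k _.
  by rewrite mxE; case: eqP => _; rewrite ?mulr1n// mulr0n scale0r.
have rPe j : g (r *m P) (e j) = 0.
  rewrite rP sformDl sformNl sform_suml sformZl.
  have [dj|dj] := eqVneq (d 0 j) (d 0 i).
    rewrite -Bee// eB sform_suml [X in _ - X](bigID (fun k => d 0 k == d 0 i)) /=.
    rewrite [X in _ - (_ + X)]big1 ?addr0 ?subrr// => k dk.
    by rewrite sformZl e_ortho ?mulr0// dj.
  rewrite big1 => [|k /eqP dk]; first by rewrite e_ortho 1?eq_sym// mulr0 subrr.
  by rewrite sformZl e_ortho ?mulr0// dk eq_sym.
have rP0 : r *m P = 0.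
  apply: nondegenerate_eq0 => // v; rewrite sformC -[v](mulmxKV Pu) mulmx_sum_row.
  by rewrite sform_suml big1// => k _; rewrite sformZl sformC rPe mulr0.
have r0 : r = 0 by rewrite -[r](mulmxK Pu) rP0 mul0mx.
move/matrixP/(_ 0 i): r0; rewrite !mxE !eqxx mulr1n mulr1 -/M => /eqP.
by rewrite subr_eq0 => /eqP.
Qed.
End Form.
End LinearAlgebra.

(** * Products of shifted matrices *)

Section ShiftProduct.
Set Implicit Arguments.
Unset Strict Implicit.
Variable n : nat.

(** Over a ring, so as to cover polynomial matrices along a line too. The head of [L] is the
    leftmost factor, which a row vector meets first. *)
Definition shift_prod (R : comNzRingType) (A : 'M[R]_n) (q : R) (L : seq R) :=
  foldr (fun l M => (A - (l * q)%:M) *m M) 1%:M L.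

Lemma map_shift_prod (R S : comNzRingType) (f : {rmorphism R -> S})
    (A : 'M[R]_n) q L :
  map_mx f (shift_prod A q L) = shift_prod (map_mx f A) (f q) (map f L).
Proof.
elim: L => [|l L IH] /=; first by rewrite map_mx1.
by rewrite map_mxM map_mxB map_scalar_mx rmorphM IH.
Qed.

Variable F : fieldType.

Lemma mul_shift_prod (A : 'M[F]_n) q L (u : 'rV[F]_n) a :
  u *m A = a *: u ->
  u *m shift_prod A q L = \prod_(l <- L) (a - l * q) *: u.
Proof.
move=> uA; elim: L => [|l L IH] /=; first by rewrite big_nil mulmx1 scale1r.
rewrite mulmxA mulmxBr uA mul_mx_scalar -scalerBl -scalemxAl IH scalerA.
by rewrite big_cons.
Qed.

Lemma shift_prod_mul (A : 'M[F]_n) q L (v : 'cV[F]_n) a :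
  A *m v = a *: v ->
  shift_prod A q L *m v = \prod_(l <- L) (a - l * q) *: v.
Proof.
move=> Av; elim: L => [|l L IH] /=; first by rewrite big_nil mul1mx scale1r.
rewrite -mulmxA IH -scalemxAr mulmxBl Av mul_scalar_mx -scalerBl scalerA.
by rewrite big_cons mulrC.
Qed.

Lemma shift_prod_eq0 (A P : 'M[F]_n) (d : 'rV[F]_n) q L :
  P \in unitmx -> P *m A *m invmx P = diag_mx d ->
  (forall i, exists2 l, l \in L & d 0 i = l * q) ->
  shift_prod A q L = 0.
Proof.
move=> Pu PA dL; rewrite -[LHS](mulKmx Pu); suff -> : P *m shift_prod A q L = 0.
  by rewrite mulmx0.
apply/row_matrixP => i; rewrite row_mul row0.
rewrite (@mul_shift_prod _ _ _ _ (d 0 i)); last exact: row_conj_diag.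
have [l lL ->] := dL i.
by rewrite (perm_big _ (perm_to_rem lL)) big_cons /= subrr mul0r scale0r.
Qed.
End ShiftProduct.

(** * Lines through an interior point *)

Section Lines.
Local Open Scope classical_set_scope.
Set Implicit Arguments.
Unset Strict Implicit.

Lemma near_line (F : numFieldType) (n : nat) (U : set 'rV[F]_n) (X Y : 'rV[F]_n) :
  U° X -> exists2 e : F, 0 < e & forall s, `|s| < e -> U (X + s *: Y).
Proof.
case: n => [|n] in U X Y * => UX.
  by exists 1 => // s _; rewrite thinmx0 -(thinmx0 X); exact: interior_subset UX.
have FF : Filter (nbhs (0 : F)) by exact: nbhs_filter.
have cf : (fun s : F => X + s *: Y) @ (0 : F) --> X + (0 : F) *: Y.
  apply: (@cvgD _ _ _ _ _ (cst X) (fun s : F => s *: Y));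
    first exact: (@cvg_cst _ X _ _ FF).
  exact: scalel_continuous.
rewrite scale0r addr0 in cf.
have /nbhs_ballP[e /= e0 eU] := cf _ UX.
by exists e => // s se; apply: eU; rewrite /ball /= sub0r normrN.
Qed.

End Lines.

(** * Jacobi operators and their restriction to lines *)

Section Osserman.
Local Open Scope classical_set_scope.
Set Implicit Arguments.
Unset Strict Implicit.
Variables (F : numFieldType) (n : nat) (g : {symmetric 'rV[F]_n}).
Variable (T : 'rV[F]_n -> 'rV[F]_n -> 'rV[F]_n -> 'rV[F]_n).
Hypotheses (g_nondeg : nondegenerate g) (T_curv : algebraic_curvature_tensor g T).
Local Notation V := 'rV[F]_n.
Local Notation q X := (g X X).
Implicit Types (W X Y Z : V) (a c s t : F).

Let T_anti X Y Z : T X Y Z = - T Y X Z.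
Proof. by case: T_curv. Qed.
Let T_pair X Y Z W : g (T X Y Z) W = g (T Z W X) Y.
Proof. by case: T_curv. Qed.
Let T_anti' X Y Z W : g (T X Y Z) W = - g (T X Y W) Z.
Proof. by rewrite T_pair T_anti linearNl T_pair. Qed.

Let T1 Y Z : linear (fun X => T X Y Z). Proof. by case: T_curv => -[]. Qed.
Let T2 X Z : linear (fun Y => T X Y Z). Proof. by case: T_curv => -[]. Qed.
Let T3 X Y : linear (fun Z => T X Y Z). Proof. by case: T_curv => -[]. Qed.

(** This is [K(X, Y)], the coefficient of [s] in the Jacobi operator at [X + s Y]. *)
Definition jacobi_polar X Y W := T W X Y + T W Y X.

Lemma jacobi_linear X : linear (jacobi T X).
Proof. by move=> c u v; rewrite /jacobi T1. Qed.

Lemma jacobi_polar_linear X Y : linear (jacobi_polar X Y).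
Proof.
by move=> c u v; rewrite /jacobi_polar !T1 scalerDr addrACA.
Qed.

Lemma linear_fun_scalable (f : V -> V) : linear f -> forall c W, f (c *: W) = c *: f W.
Proof.
move=> lf c W; have f0 : f 0 = 0.
  by have := lf (-1) 0 0; rewrite scaler0 addr0 scaleN1r addNr.
by have := lf c W 0; rewrite f0 !addr0.
Qed.

Lemma mul_lin1_mx (f : V -> V) W : linear f -> W *m lin1_mx f = f W.
Proof.
move=> lf.
pose fL : {linear V -> V} := HB.pack f (GRing.isLinear.Build _ _ _ _ f lf).
exact: (mul_rV_lin1 fL).
Qed.

Lemma mul_jacobi X W : W *m jacobi_mx T X = T W X X.
Proof. exact/mul_lin1_mx/jacobi_linear. Qed.

Definition jacobi_polar_mx X Y : 'M[F]_n := lin1_mx (jacobi_polar X Y).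

Lemma mul_jacobi_polar X Y W : W *m jacobi_polar_mx X Y = T W X Y + T W Y X.
Proof. exact/mul_lin1_mx/jacobi_polar_linear. Qed.

Lemma jacobi_mxD X Y s :
  jacobi_mx T (X + s *: Y) =
  jacobi_mx T X + s *: jacobi_polar_mx X Y + s ^+ 2 *: jacobi_mx T Y.
Proof.
apply/row_matrixP => i; rewrite !rowE !mulmxDr -!scalemxAr.
rewrite !mul_jacobi mul_jacobi_polar.
rewrite ![X + _]addrC.
have := T2 (delta_mx 0 i) (s *: Y + X) s Y X; rewrite /= => ->.
have := T3 (delta_mx 0 i) Y s Y X; have := T3 (delta_mx 0 i) X s Y X => /= -> ->.
rewrite !scalerDr scalerA -expr2.
rewrite [RHS]addrC -addrA; congr (_ + _).
by rewrite [_ + s *: T _ Y X]addrC [RHS]addrC addrA.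
Qed.

Lemma jacobi_mxZ c X : jacobi_mx T (c *: X) = c ^+ 2 *: jacobi_mx T X.
Proof.
apply/row_matrixP => i; rewrite !rowE -scalemxAr !mul_jacobi.
by rewrite (linear_fun_scalable (T2 _ _)) (linear_fun_scalable (T3 _ _)) scalerA.
Qed.

(** Pair symmetry and antisymmetry in each pair together reverse the four arguments;
    self-adjointness follows. *)
Lemma curvature_flip W X Y Z : g (T W X Y) Z = g (T Z Y X) W.
Proof. by rewrite T_pair T_anti sformNl T_anti' opprK. Qed.

Lemma jacobi_self_adjoint X : self_adjoint g (jacobi_mx T X).
Proof. by move=> u v; rewrite !mul_jacobi curvature_flip sformC. Qed.

Lemma jacobi_polar_self_adjoint X Y : self_adjoint g (jacobi_polar_mx X Y).
Proof.
move=> u v; rewrite !mul_jacobi_polar sformDl sformDr addrC.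
by congr (_ + _); rewrite curvature_flip sformC.
Qed.

(** The curvature symmetries make both summands equal to [g (T X W W) Y]. *)
Lemma jacobi_polarE X Y W :
  g (W *m jacobi_polar_mx X Y) W = 2%:R * g (jacobi T W X) Y.
Proof.
rewrite mul_jacobi_polar sformDl /jacobi.
rewrite [g (T W Y X) W]curvature_flip [T W X Y]T_anti sformNl T_anti' opprK.
by ring.
Qed.

Lemma normD X Y s : q (X + s *: Y) = q X + 2%:R * g X Y * s + q Y * s ^+ 2.
Proof.
by rewrite !(sformDl, sformDr, sformZl, sformZr) [g Y X]sformC; ring.
Qed.

(** Here and in [jacobi_line], polynomials in the parameter of a line make derivatives formal and
    extend identities from small parameters to all. *)
Definition norm_line X Y : {poly F} :=
  (q X)%:P + (2%:R * g X Y) *: 'X + q Y *: 'X^2.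

Lemma horner_norm_line X Y s : (norm_line X Y).[s] = q (X + s *: Y).
Proof. by rewrite normD !hornerE. Qed.

Lemma deriv_norm_line X Y s : (norm_line X Y)^`().[s] = 2%:R * g (X + s *: Y) Y.
Proof.
rewrite !derivD derivC !derivZ derivX derivXn !hornerE sformDl sformZl.
by ring.
Qed.

Definition jacobi_line X Y : 'M[{poly F}]_n :=
  map_mx polyC (jacobi_mx T X) + 'X *: map_mx polyC (jacobi_polar_mx X Y)
  + 'X^2 *: map_mx polyC (jacobi_mx T Y).

Lemma horner_jacobi_line X Y s :
  map_mx (horner_eval s) (jacobi_line X Y) = jacobi_mx T (X + s *: Y).
Proof.
rewrite jacobi_mxD; apply/matrixP => i j; rewrite !mxE /horner_eval.
by rewrite !(hornerE, horner_exp) mulrC [s ^+ 2 * _]mulrC.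
Qed.

Lemma deriv_jacobi_line X Y s :
  map_mx (fun p => p^`().[s]) (jacobi_line X Y) = jacobi_polar_mx (X + s *: Y) Y.
Proof.
have -> : jacobi_polar_mx (X + s *: Y) Y
    = jacobi_polar_mx X Y + (2%:R * s) *: jacobi_mx T Y.
  apply/row_matrixP => i; rewrite !rowE mulmxDr -scalemxAr.
  rewrite !mul_jacobi_polar mul_jacobi ![X + _]addrC T2 T3.
  by rewrite addrACA addrC -scalerDl -mulr2n mulr_natl.
apply/matrixP => i j; rewrite !mxE ![_ * _%:P]mulrC !mul_polyC.
rewrite !derivD derivC !derivZ derivX derivXn.
by rewrite !hornerE; ring.
Qed.

(** If [q] vanished on [U°], so would its coefficient of degree 2 on each line through an interior
    point, which is [q Y] for an arbitrary direction [Y]; polarization then contradicts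
    nondegeneracy. *)
Lemma exists_nonnull (U : set V) : (0 < n)%N -> U° !=set0 ->
  exists2 X, U° X & q X != 0.
Proof.
move=> n0 [X0 UX0]; apply: contrapT => noX.
have qU X : U° X -> q X = 0.
  by move=> UX; apply/eqP/negPn/negP => qX; apply: noX; exists X.
have q0 Y : q Y = 0.
  have [e e0 eU] : exists2 e : F, 0 < e & forall s, `|s| < e -> U° (X0 + s *: Y).
    by apply: near_line; rewrite (interior_id (U°)).1//; exact: open_interior.
  have : norm_line X0 Y = 0.
    by apply: (poly_eq0_near e0) => s se; rewrite horner_norm_line qU//; exact: eU.
  by move=> /(congr1 (fun p : {poly F} => p`_2)); rewrite !coefE/= !mulr0 !add0r mulr1.
pose i0 := Ordinal n0; pose v : V := delta_mx 0 i0.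
suff : v = 0 by move/matrixP/(_ 0 i0)/eqP; rewrite !mxE !eqxx oner_eq0.
apply: (nondegenerate_eq0 g_nondeg) => W.
have := q0 (v + W); rewrite sformDl !sformDr !q0 add0r addr0 [g W v]sformC.
by rewrite -mulr2n => /eqP; rewrite mulrn_eq0 => /eqP.
Qed.

(** * From duality to the Osserman property *)

Lemma dual_rayleigh X Y W a : duality_principle g T -> q X != 0 ->
  W *m jacobi_mx T X = a *: W ->
  g (W *m jacobi_polar_mx X Y) W = 2%:R * g X Y / q X * a * q W.
Proof.
move=> dual qX WX; rewrite jacobi_polarE.
have [->|W0] := eqVneq W 0.
  have T0 : jacobi T 0 X = 0.
    rewrite /jacobi -(scale0r (0 : V)) (linear_fun_scalable (T2 _ _)).
    by rewrite !scale0r.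
  by rewrite T0 -(scale0r (0 : V)) !sformZl !mul0r !mulr0.
(* Duality gives [J_W X = m X], and pairing with [X] determines [m] by [m q X = a q W]. *)
have [|_ [m Wm]] := dual X W qX; first by split=> //; exists a; rewrite -WX mul_jacobi.
have : g (W *m jacobi_mx T X) W = m * q X by rewrite mul_jacobi T_pair -sformZl -Wm.
rewrite WX sformZl Wm sformZl => aW.
by rewrite -mulrA aW; field; exact: qX.
Qed.

(** With [t] scaled by the norm, the eigenvalues [t q - a] scale like [q] to first order as soon as
    the eigenvalues [a] of the Jacobi operator do. *)
Definition pencil_line t X Y : 'M[{poly F}]_n :=
  (t *: norm_line X Y)%:M - jacobi_line X Y.

Lemma horner_pencil_line t X Y s :
  map_mx (horner_eval s) (pencil_line t X Y) =
  (t * q (X + s *: Y))%:M - jacobi_mx T (X + s *: Y).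
Proof.
rewrite map_mxB map_scalar_mx horner_jacobi_line; congr (_%:M - _).
by rewrite /= /horner_eval hornerZ horner_norm_line.
Qed.

Lemma horner_det (N : 'M[{poly F}]_n) s :
  (\det N).[s] = \det (map_mx (horner_eval s) N).
Proof. by rewrite det_map_mx. Qed.

Lemma horner_char_poly (A : 'M[F]_n) t : (char_poly A).[t] = \det (t%:M - A).
Proof.
rewrite horner_det map_mxB map_scalar_mx /= /horner_eval hornerX.
by congr (\det (_ - _)); apply/matrixP => i j; rewrite !mxE hornerC.
Qed.

Lemma diagonalizable_spectral (A : 'M[F]_n) : diagonalizable A ->
  exists P (d : 'rV[F]_n), P \in unitmx /\ P *m A *m invmx P = diag_mx d.
Proof.
move=> [P Pu]; rewrite /similar_to conjumx// => /diag_mxP[d PA].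
by exists P, d.
Qed.

Lemma dual_det_deriv t X Y s : duality_principle g T ->
  diagonalizable (jacobi_mx T (X + s *: Y)) -> q (X + s *: Y) != 0 ->
  (\det (pencil_line t X Y))^`().[s] =
  ((norm_line X Y)^`().[s] / (norm_line X Y).[s]
    * (\det (pencil_line t X Y)).[s]) *+ n.
Proof.
move=> dual /diagonalizable_spectral[P [d [Pu PJ]]] qs.
rewrite deriv_norm_line horner_norm_line; set k := _ / _.
apply: (@det_deriv_conj _ _ _ P s k (const_mx (t * q (X + s *: Y)) - d)) => //.
  rewrite horner_pencil_line mulmxBr mulmxBl PJ mul_mx_scalar -scalemxAl mulmxV//.
  by rewrite scalemx1 raddfB /= diag_const_mx.
move=> i.
have -> : map_mx (fun p => p^`().[s]) (pencil_line t X Y) =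
    (t * (2%:R * g (X + s *: Y) Y))%:M - jacobi_polar_mx (X + s *: Y) Y.
  rewrite -deriv_jacobi_line -deriv_norm_line.
  apply/matrixP => i' j; rewrite !mxE derivB hornerD hornerN; congr (_ - _).
  by case: eqP => _; rewrite ?mulr1n ?mulr0n ?derivC ?horner0// derivZ hornerZ.
have : (P *m jacobi_polar_mx (X + s *: Y) Y *m invmx P) i i = k * d 0 i.
  apply: (@diag_compression _ _ g (jacobi_mx T (X + s *: Y))) => //.
  - exact: jacobi_self_adjoint.
  - exact: jacobi_polar_self_adjoint.
  - by move=> u a; exact: dual_rayleigh.
rewrite mulmxBr mulmxBl mul_mx_scalar -scalemxAl mulmxV// !mxE => ->.
rewrite eqxx mulr1n mulr1 /k; move: qs (g _ Y) => /=.
by move: (q _) => b qs c; field.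
Qed.

Lemma dual_det (U : set V) X Z t : duality_principle g T ->
  (forall X, U X -> diagonalizable (jacobi_mx T X)) -> U° X -> q X != 0 ->
  \det ((t * q Z)%:M - jacobi_mx T Z) * q X ^+ n =
  \det ((t * q X)%:M - jacobi_mx T X) * q Z ^+ n.
Proof.
move=> dual Ud UX qX; pose Y := Z - X.
have [e e0 eU] := near_line Y UX.
set N := norm_line X Y; set h := \det (pencil_line t X Y).
have N0 : N.[0] = q X by rewrite horner_norm_line scale0r addr0.
have ode : N * h^`() = (N^`() * h) *+ n.
  (* The extra factor [N] absorbs the null points of the line. *)
  apply/eqP; rewrite -subr_eq0; suff /eqP : N * (N * h^`() - (N^`() * h) *+ n) = 0.
    rewrite mulf_eq0 => /orP[/eqP NE|//].
    by move: qX; rewrite -N0 NE horner0 eqxx.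
  apply: (poly_eq0_near e0) => s se; rewrite !hornerM.
  have [->|Ns] := eqVneq N.[s] 0; first by rewrite mul0r.
  rewrite [X in _ * X = _]hornerD hornerN hornerMn !hornerM (dual_det_deriv t dual).
  - by rewrite -/N -/h mulrnAr mulrA mulrCA divff// mulr1 subrr mulr0.
  - exact/Ud/eU.
  - by rewrite -horner_norm_line.
have XYZ : X + 1 *: Y = Z by rewrite scale1r /Y addrC subrK.
have := deriv_ode_expn (m := n) _ ode; rewrite N0 => /(_ qX).
move=> /(congr1 (fun p => p.[1])); rewrite !(hornerM, hornerC, horner_exp) /h.
rewrite !horner_det !horner_pencil_line /N horner_norm_line XYZ.
by rewrite scale0r addr0.
Qed.

Lemma dual_osserman (U : set V) X : duality_principle g T ->
  (forall X, U X -> diagonalizable (jacobi_mx T X)) -> U° X -> q X != 0 ->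
  osserman g T.
Proof.
move=> dual Ud UX qX.
(* By [dual_det] at [t / q Z], the coefficient of [t ^ k] at a non-null [Z] is the one at [X] times
   [(q Z / q X) ^ (n - k)]. *)
pose p k := (char_poly (jacobi_mx T X))`_k * q X ^+ k / q X ^+ n.
exists (\sum_(k < n.+1) (p k *: 'X^k)%:P * 'X^(n - k)) => Z.
apply/eqP; rewrite -subr_eq0; apply/eqP; apply: poly_eq0_horner => t.
rewrite hornerD hornerN horner_char_poly; apply/eqP; rewrite subr_eq0; apply/eqP.
transitivity (\sum_(k < n.+1) p k * t ^+ k * q Z ^+ (n - k)); last first.
  rewrite !horner_sum; apply: eq_bigr => k _.
  by rewrite hornerM hornerC horner_exp hornerX hornerM -polyC_exp hornerC !hornerE.
(* A null [Z] is reached by continuation along the line from [X], where [N] is a nonzero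
   polynomial. *)
pose Y := Z - X; set N := norm_line X Y.
have XYZ : X + 1 *: Y = Z by rewrite scale1r /Y addrC subrK.
pose h := \det (t%:P%:M - jacobi_line X Y)
          - \sum_(k < n.+1) (p k * t ^+ k) *: N ^+ (n - k).
have hE s : h.[s] = \det (t%:M - jacobi_mx T (X + s *: Y))
    - \sum_(k < n.+1) p k * t ^+ k * q (X + s *: Y) ^+ (n - k).
  rewrite hornerD hornerN horner_det map_mxB map_scalar_mx horner_jacobi_line.
  rewrite /= /horner_eval hornerC horner_sum; congr (_ - _).
  by apply: eq_bigr => k _; rewrite hornerZ horner_exp horner_norm_line.
suff h0 : h = 0.
  by have := hE 1; rewrite h0 horner0 XYZ => /esym/eqP; rewrite subr_eq0 => /eqP.
have : N * h = 0.
  apply: poly_eq0_horner => s; rewrite hornerM horner_norm_line hE.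
  have [->|qs] := eqVneq (q (X + s *: Y)) 0; first by rewrite mul0r.
  have := dual_det (X + s *: Y) (t / q (X + s *: Y)) dual Ud UX qX.
  rewrite divfK// => det_s.
  apply/eqP; rewrite mulf_eq0 (negPf qs) /= subr_eq0 -(inj_eq (mulIf (expf_neq0 n qX))).
  rewrite det_s -horner_char_poly (@horner_coef_wide _ n.+1); last first.
    by rewrite size_char_poly.
  rewrite !mulr_suml; apply/eqP/eq_bigr => k _.
  have kn : (k <= n)%N by rewrite -ltnS.
  have -> : q (X + s *: Y) ^+ n = q (X + s *: Y) ^+ (n - k) * q (X + s *: Y) ^+ k.
    by rewrite -exprD subnK.
  rewrite /p !exprMn exprVn.
  have := expf_neq0 k qs; have := expf_neq0 n qX.
  move: (_`_k) (q X ^+ n) (q X ^+ k) (t ^+ k) => a b c u.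
  by move: (_ ^+ k) (_ ^+ (n - k)) => v w b0 v0; field; rewrite b0 v0.
move=> /eqP; rewrite mulf_eq0 => /orP[/eqP N0|/eqP//].
move: qX; have := horner_norm_line X Y 0; rewrite -/N N0 horner0 scale0r addr0.
by move=> <-; rewrite eqxx.
Qed.

(** * From the Osserman property to duality *)

Lemma osserman_root (P : {poly {poly F}}) X0 X a :
  (forall X, char_poly (jacobi_mx T X) = P.[(q X)%:P]) ->
  q X0 != 0 -> q X != 0 -> root (char_poly (jacobi_mx T X)) a ->
  root (char_poly (jacobi_mx T X0)) (a / (q X / q X0)).
Proof.
move=> PE q0 qX aX; set r := q X / q X0.
have r0 : r != 0 by rewrite mulf_neq0 ?invr_eq0.
set t := a / r.
(* Homogeneity of the Jacobi operator yields [P(y t, y q X0) = y ^ n P(t, q X0)]; taking [y = r]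
   relates [X] to [X0]. *)
pose H := \sum_(i < size P) (P`_i \Po (t *: 'X)) * (q X0 *: 'X) ^+ i.
have HE y : H.[y] = P.[(y * q X0)%:P].[y * t].
  rewrite (horner_coef P) !horner_sum; apply: eq_bigr => i _.
  rewrite !hornerM !horner_exp horner_comp !hornerZ !hornerX hornerC.
  by rewrite (mulrC y (q X0)) (mulrC y t).
pose D := H - (char_poly (jacobi_mx T X0)).[t] *: 'X^n.
have D0 : D = 0.
  (* Scaling [X0] only reaches the values [c ^ 2 * q X0]; both sides being
     polynomials, this is enough, whatever the sign of [q X / q X0]. *)
  apply/eqP; rewrite -(@comp_poly_eq0 _ _ 'X^2) ?size_polyXn//.
  apply/eqP/poly_eq0_horner => c.
  rewrite horner_comp hornerXn hornerD hornerN hornerZ hornerXn HE.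
  have -> : c ^+ 2 * q X0 = q (c *: X0) by rewrite sformZl sformZr mulrA.
  rewrite -PE !horner_char_poly jacobi_mxZ -scale_scalar_mx -scalerBr detZ.
  by rewrite mulrC subrr.
have := congr1 (fun p => p.[r]) D0.
rewrite horner0 hornerD hornerN hornerZ hornerXn HE.
rewrite /r divfK// -/r /t mulrC divfK// -PE -/t.
rewrite (rootP aX) sub0r => /eqP; rewrite oppr_eq0 mulf_eq0.
by rewrite (negPf (expf_neq0 n r0)) orbF.
Qed.

Lemma osserman_spectrum X0 : osserman g T ->
  diagonalizable (jacobi_mx T X0) -> q X0 != 0 ->
  exists L : seq F, forall X W a, q X != 0 -> W != 0 ->
    W *m jacobi_mx T X = a *: W -> exists2 l, l \in L & a = l * q X.
Proof.
move=> [P PE] /diagonalizable_spectral[Q [d [Qu QJ]]] q0.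
(* These are the eigenvalues at [X0] over [q X0]: [osserman_root] sends any other eigenvalue back to
   one at [X0]. *)
exists [seq d 0 i / q X0 | i <- enum 'I_n] => X W a qX W0 WX.
have aX : root (char_poly (jacobi_mx T X)) a.
  by rewrite -eigenvalue_root_char; apply/eigenvalueP; exists W.
have := osserman_root PE q0 qX aX.
rewrite -eigenvalue_root_char => /eigenvalueP[v vX v0].
have [i vi] : exists i, (v *m invmx Q) 0 i != 0.
  apply/rV0Pn; apply: contra v0 => /eqP v0.
  by rewrite -(mulmxKV Qu v) v0 mul0mx.
exists (d 0 i / q X0); first by apply: map_f; rewrite mem_enum.
have : v *m invmx Q *m diag_mx d = (a / (q X / q X0)) *: (v *m invmx Q).
  by rewrite -QJ !mulmxA mulmxKV// vX scalemxAl.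
move: (v *m invmx Q) vi => w wi /matrixP/(_ 0 i).
rewrite mul_mx_diag !mxE mulrC => /(mulIf wi) ->.
by move: qX q0; move: (q X) (q X0) => b c b0 c0; field; rewrite b0 c0.
Qed.

(** At non-null vectors near [X0], every vector of an eigenbasis is killed by some factor;
    polynomial continuation along a line reaches [X]. *)
Lemma jacobi_prod_eq0 (U : set V) X0 X (L : seq F) :
  (forall X, U X -> diagonalizable (jacobi_mx T X)) -> U° X0 -> q X0 != 0 ->
  (forall X W a, q X != 0 -> W != 0 ->
    W *m jacobi_mx T X = a *: W -> exists2 l, l \in L & a = l * q X) ->
  shift_prod (jacobi_mx T X) (q X) L = 0.
Proof.
move=> Ud UX0 q0 LE; pose Y := X - X0.
have [e e0 eU] := near_line Y UX0.
set N := norm_line X0 Y.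
pose A := shift_prod (jacobi_line X0 Y) N (map polyC L).
have AE s : map_mx (horner_eval s) A =
    shift_prod (jacobi_mx T (X0 + s *: Y)) (q (X0 + s *: Y)) L.
  rewrite map_shift_prod horner_jacobi_line /= /horner_eval horner_norm_line.
  by rewrite -map_comp map_id_in// => l _; rewrite /= hornerC.
suff A0 : A = 0.
  have := AE 1; rewrite A0 map_mx0 scale1r /Y addrC subrK => <-//.
apply/matrixP => i j; rewrite mxE.
have : N * A i j = 0.
  apply: (poly_eq0_near e0) => s se; rewrite hornerM.
  have -> : (A i j).[s] = map_mx (horner_eval s) A i j by rewrite mxE.
  rewrite AE horner_norm_line.
  have [->|qs] := eqVneq (q (X0 + s *: Y)) 0; first by rewrite mul0r.
  have /diagonalizable_spectral[P [d [Pu PJ]]] := Ud _ (eU _ se).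
  rewrite (shift_prod_eq0 Pu PJ) ?mxE ?mulr0// => k.
  apply: (LE _ (row k P)) => //; last exact: row_conj_diag.
  apply/eqP => Pk; move/matrixP/(_ k k)/eqP: (mulmxV Pu).
  have -> : (P *m invmx P) k k = (row k P *m invmx P) 0 k
    by rewrite -row_mul [RHS]mxE.
  by rewrite Pk mul0mx !mxE eqxx eq_sym oner_eq0.
move=> /eqP; rewrite mulf_eq0 => /orP[/eqP N0|/eqP//].
move: q0; have := horner_norm_line X0 Y 0; rewrite -/N N0 horner0 scale0r addr0.
by move=> <-; rewrite eqxx.
Qed.

Lemma osserman_dual (U : set V) X0 : osserman g T ->
  (forall X, U X -> diagonalizable (jacobi_mx T X)) -> U° X0 -> q X0 != 0 ->
  duality_principle g T.
Proof.
move=> oss Ud UX0 q0 X Y qX [Y0 [a aY]].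
have [L LE] := osserman_spectrum oss (Ud _ (interior_subset UX0)) q0.
have YX : Y *m jacobi_mx T X = a *: Y by rewrite mul_jacobi -aY.
have [l lL al] := LE X Y a qX Y0 YX.
(* [l] is put first, to be the only factor that is differentiated, and removed
   from [L'], so that the other factors do not vanish on [Y]. *)
pose L' := [seq x <- L | x != l].
have LE' X' W a' : q X' != 0 -> W != 0 -> W *m jacobi_mx T X' = a' *: W ->
    exists2 l', l' \in l :: L' & a' = l' * q X'.
  move=> qX' W0 WX'; have [l' l'L ->] := LE X' W a' qX' W0 WX'.
  by exists l' => //; rewrite inE mem_filter l'L andbT orbN.
suff YY Z : g (jacobi T Y X) Z = g (l * q Y *: X) Z.
  split; first by apply: contraNneq qX => ->; rewrite -(scale0r (0 : V)) sformZl mul0r.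
  exists (l * q Y); apply/eqP; rewrite -subr_eq0; apply/eqP.
  apply: (nondegenerate_eq0 g_nondeg) => Z.
  by rewrite sformDl YY -sformDl subrr -(scale0r (0 : V)) sformZl mul0r.
pose A := jacobi_line X Z; pose N := norm_line X Z.
(* Terms of order 1 and 2 of [Y] times the factor of [l] along the line; the constant term vanishes
   by [YX]. *)
pose B := Y *m jacobi_polar_mx X Z - (l * (2%:R * g X Z)) *: Y.
pose C := Y *m jacobi_mx T Z - (l * q Z) *: Y.
have YA : map_mx polyC Y *m (A - (l%:P * N)%:M) =
    'X *: (map_mx polyC B + 'X *: map_mx polyC C).
  have YXC : map_mx polyC Y *m map_mx polyC (jacobi_mx T X) =
      (l * q X)%:P *: map_mx polyC Y.
    by rewrite -map_mxM YX al map_mxZ.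
  rewrite mulmxBr mul_mx_scalar !mulmxDr YXC -!scalemxAr -!map_mxM.
  rewrite /B /C !map_mxB !map_mxZ /N /norm_line.
  apply/matrixP => i j; rewrite !mxE -!mul_polyC !polyCM; ring.
have S0 : shift_prod A N (map polyC (l :: L')) = 0.
  apply/matrixP => i j; rewrite [RHS]mxE; apply: poly_eq0_horner => s.
  have -> : (shift_prod A N (map polyC (l :: L')) i j).[s] =
      map_mx (horner_eval s) (shift_prod A N (map polyC (l :: L'))) i j.
    by rewrite [RHS]mxE.
  rewrite map_shift_prod horner_jacobi_line /= /horner_eval horner_norm_line.
  rewrite hornerC -map_comp map_id_in => [|x _]; last by rewrite /= hornerC.
  rewrite -[X in fun_of_matrix X]/(shift_prod _ _ (l :: L')).
  by rewrite (jacobi_prod_eq0 _ Ud UX0 q0 LE') mxE.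
(* The vanishing product is divided by ['X], then evaluated at 0. *)
have BS : B *m shift_prod (jacobi_mx T X) (q X) L' = 0.
  have : (map_mx polyC B + 'X *: map_mx polyC C) *m shift_prod A N (map polyC L') = 0.
    have : 'X *: ((map_mx polyC B + 'X *: map_mx polyC C)
              *m shift_prod A N (map polyC L')) = 0.
      by rewrite scalemxAl -YA -mulmxA [X in _ *m X]S0 mulmx0.
    by move=> /eqP; rewrite scalemx_eq0 polyX_eq0 => /eqP.
  move=> /(congr1 (map_mx (horner_eval 0))).
  rewrite map_mx0 map_mxM map_mxD map_mxZ /= {2}/horner_eval hornerX scale0r addr0.
  rewrite map_shift_prod horner_jacobi_line /= /horner_eval horner_norm_line.
  rewrite scale0r addr0 -!map_comp map_id_in => [|x _]; last by rewrite /= hornerC.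
  by rewrite -map_mx_comp map_mx_id// => x; rewrite /= hornerC.
(* The second copy of [Y] is a right eigenvector, on which the factor of each [x] in [L'] acts by
   the nonzero scalar [(l - x) q X]. *)
have Av : jacobi_mx T X *m sform_col g Y = (l * q X) *: sform_col g Y.
  rewrite mul_sform_col; last exact: jacobi_self_adjoint.
  by apply/matrixP => i j; rewrite YX al !mxE sformZr.
have : B *m (shift_prod (jacobi_mx T X) (q X) L' *m sform_col g Y) = 0.
  by rewrite mulmxA BS mul0mx.
rewrite (shift_prod_mul _ _ Av) -scalemxAr mulmx_sform_col => /eqP.
rewrite scalemx_eq0 => /orP[|/eqP/matrixP/(_ 0 0)].
  rewrite prodf_seq_eq0 => /hasP[x]; rewrite mem_filter => /andP[xl _] /=.
  by rewrite -mulrBl mulf_eq0 (negPf qX) orbF subr_eq0 eq_sym (negPf xl).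
(* What remains is [g B Y = 0], which [jacobi_polarE] turns into a statement on [J_Y X]. *)
rewrite !mxE mulr1n /B sformDl jacobi_polarE sformNl sformZl => /eqP.
rewrite subr_eq0 => /eqP B0; rewrite sformZl.
apply: (@mulfI _ 2%:R); first by rewrite pnatr_eq0.
by rewrite B0; ring.
Qed.

End Osserman.

Theorem theorem2 (R : realType) (F : numFieldType)
  (F_RorC : F = (R : numFieldType) \/ F = (R[i]%C : numFieldType))
  (n : nat) (g : {symmetric 'rV[F]_n}) (g_nondeg : nondegenerate g)
  (T : 'rV[F]_n -> 'rV[F]_n -> 'rV[F]_n -> 'rV[F]_n)
  (T_curv : algebraic_curvature_tensor g T) (T_ss : semisimple T) :
  osserman g T <-> duality_principle g T.
Proof.
case: n => [|n] in g g_nondeg T T_curv T_ss *.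
  split=> _; first by move=> X Y _ []; rewrite thinmx0 eqxx.
  (* The determinant of an empty matrix is 1. *)
  by exists 1 => X; rewrite hornerC /char_poly det_mx00.
have [X UX qX] := exists_nonnull g_nondeg (ltn0Sn n) T_ss.
by split=> [oss|dual]; [apply: (osserman_dual g_nondeg T_curv oss _ UX qX)
                       |apply: (dual_osserman g_nondeg T_curv dual _ UX qX)].
Qed.
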